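(* Every finite oriented graph (with at least one vertex) whose underlying undirected graph is planar contains a strong Seymour vertex.
   Context: A digraph has no loops and no multiple arcs; $V(D)$ and $A(D)$ denote its vertex set and arc set. An oriented graph is a digraph without 2-cycles (i.e. $(u,v)$ and $(v,u)$ are never both arcs). For a vertex $v$, $N_D^+(v)=\{y:(v,y)\in A(D)\}$ is the set of out-neighbors. The second out-neighborhood of $v$ is $$N^{++}_D(v)=\{z\in V(D)\setminus (N_D^+(v)\cup\{v\}) : (v,y),(y,z)\in A(D)\text{ for some }y\in N_D^+(v)\}.$$ For disjoint vertex sets $X,Y$, a matching from $X$ to $Y$ is a set of arcs $(x_i,y_i)\in A(D)$ with $x_i\in X$, $y_i\in Y$, no two of which share an endpoint; it is a complete matching from $X$ to $Y$ if every vertex of $X$ is the tail of some arc of it (for $X=\emptyset$ the empty set is a complete matching). A vertex $x$ is a strong Seymour vertex of $D$ if there is a complete matching from $N^+_D(x)$ to $N^{++}_D(x)$. *)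

(* Defs.v *)
From HB Require Import structures.
From mathcomp Require Import all_boot all_order all_algebra.
From mathcomp Require Import all_classical all_reals all_analysis.

Set Implicit Arguments.
Unset Strict Implicit.
Unset Printing Implicit Defensive.

Import Order.TTheory GRing.Theory Num.Theory.
Import numFieldNormedType.Exports.

(* A digraph on the vertex set V is an irreflexive relation [arc : rel V];
   using a relation already excludes multiple arcs. *)
Definition digraph (V : finType) (arc : rel V) : Prop := irreflexive arc.

Definition oriented (V : finType) (arc : rel V) : Prop :=
  digraph arc /\ forall u v : V, ~ (arc u v /\ arc v u).

Definition underlying (V : finType) (arc : rel V) : rel V :=
  fun u v => arc u v || arc v u.

Definition out_nbr (V : finType) (arc : rel V) (v : V) : {set V} :=
  [set y | arc v y]%SET.

Definition second_out_nbr (V : finType) (arc : rel V) (v : V) : {set V} :=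
  [set z | (z \notin v |: out_nbr arc v) &&
           [exists y in out_nbr arc v, arc v y && arc y z]]%SET.

Definition share_endpoint (V : finType) (a b : V * V) : bool :=
  [|| a.1 == b.1, a.1 == b.2, a.2 == b.1 | a.2 == b.2].

Definition matching (V : finType) (arc : rel V) (X Y : {set V})
    (M : {set V * V}) : Prop :=
  (forall a, a \in M -> [/\ arc a.1 a.2, a.1 \in X & a.2 \in Y]) /\
  (forall a b, a \in M -> b \in M -> a != b -> ~~ share_endpoint a b).

Definition complete_matching (V : finType) (arc : rel V) (X Y : {set V})
    (M : {set V * V}) : Prop :=
  matching arc X Y M /\
  forall x, x \in X -> exists2 a, a \in M & a.1 = x.

Definition strong_seymour (V : finType) (arc : rel V) (x : V) : Prop :=
  exists M : {set V * V},
    complete_matching arc (out_nbr arc x) (second_out_nbr arc x) M.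

Local Open Scope classical_set_scope.
Local Open Scope ring_scope.

Definition simple_arc (R : realType) (C : set (R * R)) (a b : R * R) : Prop :=
  exists f : R -> R * R,
    [/\ {within `[0, 1], continuous f},
        {in `[0, 1] &, injective f},
        f 0 = a,
        f 1 = b
      & C = f @` `[0, 1]].

(* [e] is the adjacency relation of a simple undirected graph.  The edge
   joining u and v is the unordered pair [set u; v], drawn as the point set
   [C [set u; v]]; the values of C at non-edges are irrelevant. *)
Definition plane_drawing (R : realType) (V : finType) (e : rel V)
    (p : V -> R * R) (C : {set V} -> set (R * R)) : Prop :=
  let E u v := C [set u; v]%SET in
  let inner_part u v := E u v `\` [set p u; p v] in
  [/\ injective p,
      forall u v, e u v -> simple_arc (E u v) (p u) (p v),
      forall u v w, e u v -> ~ inner_part u v (p w)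
    & forall u v x y, e u v -> e x y -> [set u; v]%SET <> [set x; y]%SET ->
        inner_part u v `&` E x y = set0].

Definition planar (R : realType) (V : finType) (e : rel V) : Prop :=
  exists (p : V -> R * R) (C : {set V} -> set (R * R)), plane_drawing e p C.

(* Main.v *)
Require Import Defs.
From mathcomp Require Import all_boot all_order all_algebra.
From mathcomp Require Import all_classical all_reals all_analysis.
From mathcomp Require Import zify lra.

(* A vertex of minimum out-degree at most 2 is a strong Seymour vertex, so it
   suffices that a planar oriented graph on n vertices has fewer than 3n arcs.
   As in MacLane's criterion, planarity is used in the form that the cycle space
   over F_2 is spanned by face boundaries, every edge lying on at most two of
   them: at least m - n + 1 boundaries are then nonzero, each has at least three
   edges, and so 3(m - n + 1) <= 2m.  A finite square grid has such a family of
   faces, and the property passes to minors.  A plane drawing yields a grid minor: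
   cut every arc into thirds, let the star of a vertex collect the adjacent outer
   thirds, and replace the stars and the middle thirds, which are compact and
   connected, by the sets of cells of a fine grid that they meet. *)

Set Implicit Arguments.
Unset Strict Implicit.
Unset Printing Implicit Defensive.
Import Order.TTheory GRing.Theory Num.Theory.
Import numFieldNormedType.Exports.

(** * Vertices of small out-degree *)

Section StrongSeymour.
Variables (V : finType) (arc : rel V).
Hypothesis arc_oriented : oriented arc.

Let irr v : arc v v = false. Proof. exact: (arc_oriented.1 v). Qed.
Let asym u v : arc u v -> arc v u = false.
Proof. by move=> uv; apply/negP => vu; apply: (arc_oriented.2 u v). Qed.

(** The matching consists of the arcs [(y, g y)]. Without 2-cycles [g y] is not [x], and no head is
    a tail because the tails are out-neighbours of [x] and the heads are not. *)
Lemma strong_seymour_inj (x : V) (g : V -> V) :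
  {in out_nbr arc x &, injective g} ->
  (forall y, arc x y -> arc y (g y) && ~~ arc x (g y)) ->
  strong_seymour arc x.
Proof.
move=> g_inj gP.
exists [set (y, g y) | y in out_nbr arc x]; split; last first.
  by move=> y xy; exists (y, g y) => //; apply: imset_f.
split=> [_ /imsetP[y xy ->]|_ _ /imsetP[y xy ->] /imsetP[z xz ->]] /=.
  have := xy; rewrite inE => xy'; have /andP[ygy xgy] := gP y xy'.
  split=> //; rewrite inE !inE negb_or xgy andbT; apply/andP; split.
    by apply: contraTneq ygy => ->; rewrite asym.
  by apply/existsP; exists y; rewrite inE xy' ygy.
move: (xy) (xz); rewrite !inE => xy' xz'.
have /andP[_ ngy] := gP y xy'; have /andP[_ ngz] := gP z xz'.
rewrite xpair_eqE negb_and => ne; rewrite /share_endpoint /=.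
have yz : y != z by apply: contraTneq ne => ->; rewrite !eqxx.
rewrite (negbTE yz) /=; apply/norP; split.
  by apply: contraNneq ngz => <-.
apply/norP; split; first by apply: contraNneq ngy => ->.
by apply: contraNneq yz => /g_inj ->.
Qed.

Let outP x k : (k < #|out_nbr arc x|)%N -> forall s : seq V, (size s <= k)%N ->
  exists2 y, arc x y & y \notin s.
Proof.
move=> kx s sk; have /fintype.subsetPn[y] : ~~ (out_nbr arc x \subset s).
  apply/negP => /subset_leq_card; rewrite leqNgt => /negP; apply.
  by apply: leq_ltn_trans kx; apply: leq_trans sk; apply: card_size.
by rewrite inE => xy ys; exists y.
Qed.

(** By minimality each out-neighbour of [x] has at least as many out-neighbours as [x], which leaves
    room to choose distinct targets greedily. *)
Lemma strong_seymour_min_out_le2 (x : V) :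
  (#|out_nbr arc x| <= 2)%N ->
  (forall y, (#|out_nbr arc x| <= #|out_nbr arc y|)%N) ->
  strong_seymour arc x.
Proof.
set d := #|out_nbr arc x| => d2 dmin.
case: (posnP d) => [d0|d_gt0].
  have N0 := cards0_eq d0; apply: (@strong_seymour_inj _ id) => y.
    by rewrite N0 inE.
  by move=> xy; have yN : y \in out_nbr arc x by [rewrite inE]; rewrite N0 inE in yN.
move: d2; rewrite leq_eqVlt ltnS => /orP[/cards2P[a [b [ab Nx]]]|d1].
  have dE : d = 2 by rewrite /d Nx cards2 ab.
  (* There are no 2-cycles, so up to exchanging [a] and [b] the pair [b a] is not an arc. Then only
     the target of [a] must be made to avoid the other vertex, and the target of [b] is free to
     avoid [ga]. *)
  wlog nba : a b ab Nx / arc b a = false.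
    move=> W; case ba: (arc b a); last by apply: (W a b).
    by apply: (W b a); [rewrite eq_sym | rewrite finset.setUC | apply: asym].
  have memN y : arc x y = (y == a) || (y == b).
    by have := erefl (y \in out_nbr arc x); rewrite {1}inE Nx !inE.
  have [ga aga gab] : exists2 y, arc a y & y \notin [:: b].
    by apply: (@outP a 1); rewrite // -dE.
  have [gb bgb gba] : exists2 y, arc b y & y \notin [:: ga].
    by apply: (@outP b 1); rewrite // -dE.
  rewrite inE in gab; rewrite inE in gba.
  apply: (@strong_seymour_inj _ (fun y => if y == a then ga else gb)).
    move=> y z; rewrite Nx !inE => /orP[]/eqP-> /orP[]/eqP->;
      rewrite ?eqxx ?[b == a]eq_sym ?(negbTE ab) // => E;
      by move: gba; rewrite E eqxx.
  move=> y; rewrite memN => /orP[]/eqP->; rewrite ?eqxx ?[b == a]eq_sym ?(negbTE ab).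
    rewrite aga memN negb_or gab andbT /=.
    by apply: contraTneq aga => ->; rewrite irr.
  rewrite bgb memN negb_or /=; apply/andP; split.
    by apply: contraTneq bgb => ->; rewrite nba.
  by apply: contraTneq bgb => ->; rewrite irr.
have /eqP/cards1P[a Nx] : d = 1 by apply/eqP; rewrite eqn_leq d1.
have memN y : arc x y = (y == a).
  by have := erefl (y \in out_nbr arc x); rewrite {1}inE Nx !inE.
have [ga aga _] : exists2 y, arc a y & y \notin [::].
  by apply: (@outP a 0) => //; apply: leq_trans (dmin a).
apply: (@strong_seymour_inj _ (fun=> ga)).
  by move=> y z; rewrite Nx !inE => /eqP-> /eqP->.
move=> y; rewrite memN => /eqP->; rewrite aga memN /=.
by apply: contraTneq aga => ->; rewrite irr.
Qed.

(** The out-degrees sum to the number of arcs, so their minimum is at most 2. *)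
Lemma strong_seymour_few_arcs :
  (#|[set a : V * V | arc a.1 a.2]| < 3 * #|V|)%N -> exists x, strong_seymour arc x.
Proof.
move=> few.
have /existsP[v0 _] : [exists v : V, true].
  have /card_gt0P[v _] : (0 < #|V|)%N by case: #|V| few => //; rewrite muln0.
  by apply/existsP; exists v.
case: (@arg_minnP _ v0 predT (fun v => #|out_nbr arc v|)) => // x _ xmin.
exists x; apply: strong_seymour_min_out_le2 => [|y]; last exact: xmin.
rewrite leqNgt; apply/negP => x3; move: few; rewrite ltnNge => /negP; apply.
have -> : #|[set a : V * V | arc a.1 a.2]| = (\sum_(v : V) #|out_nbr arc v|)%N.
  rewrite -sum1_card big_mkcond /=.
  rewrite (eq_bigr (fun a : V * V => if arc a.1 a.2 then 1 else 0)%N); last first.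
    by move=> a _; rewrite inE.
  rewrite -(pair_bigA _ (fun u v => if arc u v then 1 else 0)%N) /=.
  apply: eq_bigr => u _; rewrite -sum1_card [RHS]big_mkcond /=.
  by apply: eq_bigr => v _; rewrite inE.
rewrite mulnC -sum_nat_const; apply: leq_sum => v _.
exact: leq_trans x3 (xmin v isT).
Qed.

End StrongSeymour.

(** * Cycle space and faces *)

Section CycleSpace.
Local Open Scope ring_scope.

Lemma F2_addxx (a : 'F_2) : a + a = 0.
Proof. by apply: addrr_pchar2; apply: pchar_Fp. Qed.

Lemma F2_add_eq0 (a b : 'F_2) : (a + b == 0) = (a == b).
Proof. by rewrite addr_eq0 (oppr_pchar2 (pchar_Fp _)). Qed.

(** Elements of the cycle space: an edge set is encoded by its symmetric indicator on ordered pairs,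
    and the last clause makes all degrees even. *)
Definition even_chain (P : finType) (e : rel P) (x : P -> P -> 'F_2) : Prop :=
  [/\ forall s t, x s t = x t s,
      forall s t, ~~ e s t -> x s t = 0
    & forall s, \sum_t x s t = 0].

(* [L s t] and [R s t] are the faces on the two sides of the edge st; the chain of
   a function [c] on faces is the sum of the boundaries of the faces in its support. *)
Definition planar_dual (P T : finType) (e : rel P) (L R : P -> P -> T) : Prop :=
  (forall x, even_chain e x -> exists c : T -> 'F_2,
     forall s t, e s t -> x s t = c (L s t) + c (R s t)) /\
  (forall c : T -> 'F_2,
     even_chain e (fun s t => if e s t then c (L s t) + c (R s t) else 0)).

(** The row space is the sum of the lines spanned by the nonzero rows. *)
Lemma mxrank_le_nz_rows (F : fieldType) (m n : nat) (A : 'M[F]_(m, n)) :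
  (\rank A <= #|[set i | row i A != 0%R]|)%N.
Proof.
have sub : (A <= \sum_(i in [set i | row i A != 0%R]) <<row i A>>)%MS.
  apply/row_subP => i; case: (eqVneq (row i A) 0) => [->|nz]; first exact: sub0mx.
  by apply: (sumsmx_sup i); rewrite ?inE ?genmxE.
apply: leq_trans (mxrankS sub) _.
apply: leq_trans (mxrank_sum_leqif _) _ => /=.
rewrite -sum1_card; apply: leq_sum => i _.
by rewrite genmxE; apply: rank_leq_row.
Qed.

(* The edges uv, vw and wy are distinct: a nonzero cycle has length at least three. *)
Lemma even_chain_three (P : finType) (e : rel P) (x : P -> P -> 'F_2) u v :
  irreflexive e -> even_chain e x -> x u v != 0 ->
  exists w y, [/\ x v w != 0, x w y != 0, w != u & y != v].
Proof.
move=> irr [xC x0 xS] xuv.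
have step a b : x a b != 0 -> exists2 d, x b d != 0 & d != a.
  move=> xab; apply/exists_inP; apply: contraNT xab => /exists_inPn H.
  have := xS b; rewrite (bigD1 a) //= big1 ?addr0 => [<-|d da].
    by rewrite xC.
  by apply/eqP/negPn/negP => /H; rewrite da.
have [w xvw wu] := step _ _ xuv.
have [y xwy yv] := step _ _ xvw.
by exists w, y.
Qed.

Lemma planar_dual_few_arcs (V T : finType) (arc : rel V) (L R : V -> V -> T) :
  (0 < #|V|)%N -> oriented arc -> planar_dual (underlying arc) L R ->
  (#|[set a : V * V | arc a.1 a.2]| < 3 * #|V|)%N.
Proof.
move=> V0 [irr asym] [D1 D2].
set A := [set a : V * V | arc a.1 a.2]; set m := #|A|; set e := underlying arc.
pose ed (i : 'I_m) : V * V := enum_val i.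
have edP i : arc (ed i).1 (ed i).2 by have := enum_valP i; rewrite inE.
have ed_inj : injective ed by exact: enum_val_inj.
have ed_surj u v : arc u v -> exists i, ed i = (u, v).
  move=> uv; have uvA : (u, v) \in A by rewrite inE.
  by exists (enum_rank_in uvA (u, v)); rewrite /ed enum_rankK_in.
have irr_e : irreflexive e by move=> u; rewrite /e /underlying irr.
(* The incidence matrix of edges and vertices; its left kernel is the cycle space. *)
pose D : 'M['F_2]_(m, #|V|) :=
  \matrix_(i, j) (((ed i).1 == enum_val j)%:R + ((ed i).2 == enum_val j)%:R).
pose lr (i : 'I_m) (c : T -> 'F_2) := c (L (ed i).1 (ed i).2) + c (R (ed i).1 (ed i).2).
(* Row [t] is the boundary of the face [t]; an edge with [t] on both sides gets 1 + 1 = 0. *)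
pose B : 'M['F_2]_(#|T|, m) :=
  \matrix_(t, i) lr i (fun y => (y == enum_val t)%:R).
have kerB : (kermx D <= B)%MS.
  apply/rV_subP => z /sub_kermxP zD.
  (* The vector [z] as a chain on ordered pairs; without 2-cycles at most one of the two sums has a
     term. *)
  pose x u v := \sum_(i | ed i == (u, v)) z 0 i + \sum_(i | ed i == (v, u)) z 0 i.
  have x_ed i : x (ed i).1 (ed i).2 = z 0 i.
    rewrite /x (big_pred1 i) => [|j]; last first.
      by rewrite -surjective_pairing (inj_eq ed_inj).
    rewrite big_pred0 ?addr0 // => j; apply/eqP => E.
    by apply: (asym _ _ (conj (edP i) _)); have := edP j; rewrite E.
  have [c cP] : exists c : T -> 'F_2, forall s t, e s t -> x s t = c (L s t) + c (R s t).
    apply: D1; split.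
    - by move=> u v; rewrite /x addrC.
    - move=> u v; rewrite /underlying => /norP[uv vu]; rewrite /x !big_pred0 ?addr0 //.
        by move=> j; apply/eqP => E; move: (edP j) vu; rewrite E /= => ->.
      by move=> j; apply/eqP => E; move: (edP j) uv; rewrite E /= => ->.
    - move=> u.
      transitivity ((z *m D) 0 (enum_rank u)); last by rewrite zD mxE.
      rewrite mxE /x big_split /= (exchange_big_dep predT) //=.
      rewrite [X in _ + X](exchange_big_dep predT) //= -big_split /=.
      apply: eq_bigr => i _; rewrite mxE enum_rankK mulrDr; congr (_ + _).
        case: (eqVneq (ed i).1 u) => [<-|ne]; rewrite ?mulr1 ?mulr0.
          rewrite (big_pred1 (ed i).2) // => v.
          by rewrite {1}[ed i]surjective_pairing xpair_eqE eqxx eq_sym.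
        by rewrite big_pred0 // => v; apply: contraNF ne => /eqP->.
      case: (eqVneq (ed i).2 u) => [<-|ne]; rewrite ?mulr1 ?mulr0.
        rewrite (big_pred1 (ed i).1) // => v.
        by rewrite {1}[ed i]surjective_pairing xpair_eqE eqxx andbT eq_sym.
      by rewrite big_pred0 // => v; apply: contraNF ne => /eqP->.
  apply/submxP; exists (\row_t c (enum_val t)); apply/rowP => i.
  rewrite -x_ed cP; last by rewrite /e /underlying edP.
  rewrite mxE; under eq_bigr do rewrite !mxE mulrDr.
  have pick y : \sum_(t < #|T|) c (enum_val t) * (y == enum_val t)%:R = c y.
    rewrite (bigD1 (enum_rank y)) //= enum_rankK eqxx mulr1 big1 ?addr0 // => t ty.
    by rewrite (negbTE (_ : y != _)) ?mulr0 //; apply: contraNneq ty => ->; rewrite enum_valK.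
  by rewrite big_split /= !pick.
have rkD : (\rank D < #|V|)%N.
  (* Every edge has two ends, so the all-one vector is in the kernel and the rank drops by one. *)
  have D_one : D *m (const_mx 1 : 'cV_#|V|) = 0.
    apply/matrixP => i j; rewrite !mxE.
    under eq_bigr do rewrite !mxE mulr1.
    have one y : \sum_(t < #|V|) (y == enum_val t)%:R = 1 :> 'F_2.
      rewrite (bigD1 (enum_rank y)) //= enum_rankK eqxx big1 ?addr0 // => t ty.
      by rewrite (negbTE (_ : y != _)) //; apply: contraNneq ty => ->; rewrite enum_valK.
    by rewrite big_split /= !one F2_addxx.
  have := mulmx0_rank_max D_one; apply: leq_trans.
  rewrite -addn1 leq_add2l lt0n mxrank_eq0; apply/eqP => /matrixP/(_ (Ordinal V0) 0).
  by rewrite !mxE.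
set K := [set t | row t B != 0].
have rkB : (m - \rank D <= #|K|)%N.
  by rewrite -mxrank_ker; apply: leq_trans (mxrankS kerB) (mxrank_le_nz_rows B).
(* An edge lies only on the boundaries of the faces at its two sides. *)
have cols : (\sum_(t in K) #|[set i | B t i != 0%R]| <= 2 * m)%N.
  have -> : (2 * m = \sum_(i < m) 2)%N by rewrite sum_nat_const card_ord mulnC.
  have -> : (\sum_(t in K) #|[set i | B t i != 0%R]|
             = \sum_(t in K) \sum_(i < m) (B t i != 0%R))%N.
    apply: eq_bigr => t _; rewrite -sum1_card big_mkcond /=.
    by apply: eq_bigr => i _; rewrite inE; case: ifP.
  rewrite exchange_big /=; apply: leq_sum => i _.
  apply: leq_trans (_ : #|[set enum_rank (L (ed i).1 (ed i).2);
                               enum_rank (R (ed i).1 (ed i).2)]| <= 2)%N;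
    last by rewrite cards2; case: eqP.
  rewrite big_mkcond -[leqRHS]sum1_card [leqRHS]big_mkcond /=; apply: leq_sum => t _.
  rewrite mxE /lr !inE; case: ifP => // _.
  case: (eqVneq t _) => [_|tL] /=; first by case: (_ != _).
  case: (eqVneq t _) => [_|tR] /=; first by case: (_ != _).
  have ne y : t != enum_rank y -> (y == enum_val t) = false.
    by move=> H; apply: contraNF H => /eqP->; rewrite enum_valK.
  by rewrite !ne // addr0 eqxx.
(* The boundary of a single face is an even chain, so a nonzero row has three consecutive distinct
   edges. *)
have rows : (3 * #|K| <= \sum_(t in K) #|[set i | B t i != 0%R]|)%N.
  rewrite mulnC -sum_nat_const; apply: leq_sum => t; rewrite inE => /rV0Pn[i].
  rewrite mxE => Bti.
  have cyc := D2 (fun y => (y == enum_val t)%:R); set x := (fun s _ => _) in cyc.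
  have xB a b : x a b != 0 -> exists2 i, B t i != 0 & [set a; b] = [set (ed i).1; (ed i).2].
    have [xC x0 _] := cyc.
    move=> xab; have : e a b by apply: contraNT xab => /x0->.
    case/orP => /ed_surj[k kE]; exists k; rewrite ?mxE /lr ?kE //=.
    - move: xab; rewrite /x; by case: ifP; rewrite ?eqxx.
    - move: xab; rewrite xC /x; by case: ifP; rewrite ?eqxx.
    - by rewrite finset.setUC.
  have xi : x (ed i).1 (ed i).2 != 0.
    by rewrite /x /underlying edP /=; move: Bti; rewrite mxE.
  have [w [y [xvw xwy wu yv]]] := even_chain_three irr_e cyc xi.
  have neq a b : x a b != 0 -> a != b.
    have [xC x0 _] := cyc.
    by apply: contraNneq => ->; rewrite (x0 _ _ (negbT (irr_e b))).
  move: (xi) (xvw) (xwy) => /xB[i1 B1 E1] /xB[i2 B2 E2] /xB[i3 B3 E3].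
  have i12 : i1 != i2.
    apply: contraNneq wu => i12; have := set21 (ed i).1 (ed i).2.
    rewrite E1 i12 -E2 !inE (negbTE (neq _ _ xi)) /= => /eqP->; exact: eqxx.
  have i23 : i2 != i3.
    apply: contraNneq yv => i23; have := set21 (ed i).2 w.
    rewrite E2 i23 -E3 !inE (negbTE (neq _ _ xvw)) /= => /eqP->; exact: eqxx.
  have i13 : i1 != i3.
    apply: contraNneq wu => i13; have := set21 w y.
    by rewrite E3 -i13 -E1 !inE [w == (ed i).2]eq_sym (negbTE (neq _ _ xvw)) orbF.
  apply: leq_trans (_ : #|[set i1; i2; i3]| <= _)%N.
    by rewrite finset.setUC cardsU1 cards2 i12 !inE ![i3 == _]eq_sym (negbTE i13) (negbTE i23).
  apply/subset_leq_card/fintype.subsetP => j.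
  by rewrite !inE => /orP[/orP[]|] /eqP->.
(* With n vertices the bounds give 3(m - n + 1) <= 2m, that is m <= 3n - 3. *)
suff : (3 * m < 3 * (3 * #|V|))%N by rewrite ltn_pmul2l.
lia.
Qed.

(** * Minors *)

(** Connectivity in the form of an induction principle, which avoids explicit paths; the empty set
    counts as connected. *)
Definition connected_in (P : finType) (e : rel P) (A : {set P}) : Prop :=
  forall X : P -> Prop, (exists2 s, s \in A & X s) ->
    (forall s t, s \in A -> t \in A -> e s t -> X s -> X t) ->
    forall s, s \in A -> X s.

(** Every edge inside [A] is counted once from each end. *)
Lemma chain_in_sum0 (P : finType) (x : P -> P -> 'F_2) (A : {set P}) :
  (forall s t, x s t = x t s) -> (forall s, x s s = 0) ->
  \sum_(s in A) \sum_(t in A) x s t = 0.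
Proof.
move=> xC x0; under eq_bigr do rewrite -big_enum /=.
rewrite -big_enum /=; elim: (enum A) => [|a r IH]; first by rewrite big_nil.
rewrite big_cons big_cons x0 add0r.
under [X in _ + X]eq_bigr do rewrite big_cons xC.
by rewrite big_split /= IH addr0 F2_addxx.
Qed.

(** The chain of a path from [s] to [t]; adding an edge [tu] moves the end from [t] to [u]. *)
Lemma connected_in_path_chain (P : finType) (e : rel P) (A : {set P}) s t :
  symmetric e -> irreflexive e -> connected_in e A -> s \in A -> t \in A ->
  exists y : P -> P -> 'F_2,
    [/\ forall a b, y a b = y b a,
        forall a b, ~~ [&& e a b, a \in A & b \in A] -> y a b = 0
      & forall a, \sum_b y a b = (a == s)%:R + (a == t)%:R].
Proof.
move=> eC eI conA sA; move: t; apply: conA => [|t u tA uA etu [y [yC y0 yS]]].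
  exists s => //; exists (fun _ _ => 0); split=> // a.
  by rewrite big1 // F2_addxx.
have tu : t != u by apply: contraTneq etu => ->; rewrite eI.
pose E a b : 'F_2 := ((a == t) && (b == u))%:R + ((a == u) && (b == t))%:R.
exists (fun a b => y a b + E a b); split.
- move=> a b; rewrite yC /E; congr (_ + _).
  by rewrite addrC [(a == u) && _]andbC [(a == t) && _]andbC.
- move=> a b nab; rewrite y0 // add0r /E.
  case: andP => [[/eqP aE /eqP bE]|_]; first by move: nab; rewrite aE bE etu tA uA.
  case: andP => [[/eqP aE /eqP bE]|_]; last by rewrite addr0.
  by move: nab; rewrite aE bE eC etu tA uA.
- move=> a; rewrite big_split /= yS -addrA; congr (_ + _).
  have one (p : bool) (w : P) : \sum_b (p && (b == w))%:R = p%:R :> 'F_2.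
    rewrite (bigD1 w) //= eqxx andbT big1 ?addr0 // => b bw.
    by rewrite (negbTE bw) andbF.
  by rewrite /E big_split /= !one addrA F2_addxx add0r.
Qed.

(** Paths from a fixed [s] to each [t], weighted by [d t], are superposed; the weights sum to zero,
    so the common starting point contributes nothing. *)
Lemma connected_in_chain (P : finType) (e : rel P) (A : {set P}) (d : P -> 'F_2) :
  symmetric e -> irreflexive e -> connected_in e A ->
  (forall a, a \notin A -> d a = 0) -> \sum_a d a = 0 ->
  exists y : P -> P -> 'F_2,
    [/\ forall a b, y a b = y b a,
        forall a b, ~~ [&& e a b, a \in A & b \in A] -> y a b = 0
      & forall a, \sum_b y a b = d a].
Proof.
move=> eC eI conA d0 dS.
case: (set_0Vmem A) => [A0|[s sA]].
  by exists (fun _ _ => 0); split=> // a; rewrite big1 // d0 // A0 inE.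
have /choice[Y YP] : forall t, exists y : P -> P -> 'F_2, t \in A ->
    [/\ forall a b, y a b = y b a,
        forall a b, ~~ [&& e a b, a \in A & b \in A] -> y a b = 0
      & forall a, \sum_b y a b = (a == s)%:R + (a == t)%:R].
  move=> t; case tA: (t \in A); last by exists (fun _ _ => 0).
  by have [y yP] := connected_in_path_chain eC eI conA sA tA; exists y.
exists (fun a b => \sum_(t in A) d t * Y t a b); split.
- by move=> a b; apply: eq_bigr => t /YP[YC _ _]; rewrite YC.
- by move=> a b nab; apply: big1 => t /YP[_ Y0 _]; rewrite Y0 ?mulr0.
- move=> a; rewrite exchange_big /=.
  transitivity (\sum_(t in A) d t * ((a == s)%:R + (a == t)%:R)).
    by apply: eq_bigr => t /YP[_ _ YS]; rewrite -mulr_sumr YS.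
  have dA : \sum_(t in A) d t = 0.
    by rewrite -[RHS]dS [RHS](bigID (mem A)) /= [X in _ + X]big1 ?addr0.
  under eq_bigr do rewrite mulrDr.
  rewrite big_split /= -mulr_suml dA mul0r add0r.
  case aA: (a \in A).
    rewrite (bigD1 a) //= eqxx mulr1 big1 ?addr0 // => t /andP[_ ta].
    by rewrite eq_sym (negbTE ta) mulr0.
  rewrite d0 ?aA // big1 // => t tA; case: eqP => [E|]; last by rewrite mulr0.
  by move: tA; rewrite -E aA.
Qed.

Lemma connect_const (T : finType) (r : rel T) (C : eqType) (c : T -> C) :
  (forall a b, r a b -> c a = c b) -> forall a b, connect r a b -> c a = c b.
Proof.
move=> rc a b /connectP[p + ->]; elim: p a => //= u p IH a /andP[/rc-> /IH->].
by [].
Qed.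

(** Edges inside a branch set are contracted, and for each edge [uv] of [g] the edge from [rho u v]
    to [rho v u] is kept. All others are deleted, which merges the faces on their two sides: the
    faces of the minor are the classes generated by [r]. *)
Lemma planar_dual_minor (P T V : finType) (e : rel P) (L R : P -> P -> T)
    (g : rel V) (b : V -> {set P}) (rho : V -> V -> P) :
  symmetric e -> irreflexive e -> symmetric g -> irreflexive g ->
  planar_dual e L R ->
  (forall u v s, s \in b u -> s \in b v -> u = v) ->
  (forall v, connected_in e (b v)) ->
  (forall u v, g u v -> rho u v \in b u) ->
  (forall u v, g u v -> e (rho u v) (rho v u)) ->
  exists L' R' : V -> V -> T, planar_dual g L' R'.
Proof.
move=> eC eI gC gI [D1 D2] bI bcon rhob rhoe.
have guv u v : g u v -> u != v by apply: contraTneq => ->; rewrite gI.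
pose inH s t := [exists v, (s \in b v) && (t \in b v)]
  || [exists u, exists v, [&& g u v, s == rho u v & t == rho v u]].
pose r : rel T := fun x y => [exists s, exists t, [&& e s t, ~~ inH s t &
  ((x == L s t) && (y == R s t)) || ((x == R s t) && (y == L s t))]].
have rC : connect_sym r.
  apply: sym_connect_sym => x y; apply/existsP/existsP => -[s /existsP[t /and3P[? ? H]]];
    by exists s; apply/existsP; exists t; apply/and3P; split;
    rewrite // orbC andbC [X in _ || X]andbC.
exists (fun u v => fingraph.root r (L (rho u v) (rho v u))),
       (fun u v => fingraph.root r (R (rho u v) (rho v u))).
split=> [z [zC z0 zS]|c].
  (* To lift [z], a chain inside each branch set repairs the parities at the ends of the kept edges;
     it exists because [z] has even degree at [v]. *)
  have /choice[y yP] : forall v, exists y : P -> P -> 'F_2,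
    [/\ forall s t, y s t = y t s,
        forall s t, ~~ [&& e s t, s \in b v & t \in b v] -> y s t = 0
      & forall s, \sum_t y s t = \sum_u z v u * (s == rho v u)%:R].
    move=> v; apply: connected_in_chain => //.
      move=> s sb; apply: big1 => u _; case gvu: (g v u); last by rewrite z0 ?gvu ?mul0r.
      case: eqP => [E|]; last by rewrite mulr0.
      by move: sb; rewrite E rhob.
    rewrite exchange_big /= -[RHS](zS v); apply: eq_bigr => u _.
    rewrite -mulr_sumr (bigD1 (rho v u)) //= eqxx big1 ?addr0 ?mulr1 // => s.
    by move/negbTE->.
  pose x s t := \sum_v y v s t +
    \sum_u \sum_v z u v * ((s == rho u v)%:R * (t == rho v u)%:R).
  have x_even : even_chain e x.
    split.
    - move=> s t; rewrite /x; congr (_ + _).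
        by apply: eq_bigr => v _; have [yC _ _] := yP v.
      rewrite exchange_big /=; apply: eq_bigr => u _; apply: eq_bigr => v _.
      by rewrite zC mulrC [X in X * _]mulrC mulrC.
    - move=> s t nst; rewrite /x big1 ?add0r => [|v _]; last first.
        by have [_ y0 _] := yP v; rewrite y0 // (negbTE nst).
      apply: big1 => u _; apply: big1 => v _.
      case gvu: (g u v); last by rewrite z0 ?gvu ?mul0r.
      case: eqP => [E|]; last by rewrite mul0r mulr0.
      case: eqP => [E'|]; last by rewrite !mulr0.
      by move: nst; rewrite E E' rhoe.
    - move=> s; rewrite /x big_split /= exchange_big /=.
      rewrite [X in _ + X]exchange_big /=.
      under [X in _ + X]eq_bigr do rewrite exchange_big /=.
      rewrite -big_split /= big1 // => u _; have [_ _ ->] := yP u.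
      rewrite -big_split /= big1 // => v _.
      rewrite -!mulr_sumr (bigD1 (rho v u)) //= eqxx big1 => [|t /negbTE->//].
      by rewrite addr0 mulr1 F2_addxx.
  have [c cP] := D1 x x_even.
  have x_out s t : ~~ inH s t -> x s t = 0.
    rewrite negb_or => /andP[/existsPn H1 /existsPn H2]; rewrite /x.
    rewrite big1 ?add0r => [|v _]; last first.
      by have [_ y0 _] := yP v; rewrite y0 // negb_and (H1 v) orbT.
    apply: big1 => u _; apply: big1 => v _.
    case gvu: (g u v); last by rewrite z0 ?gvu ?mul0r.
    have /existsPn/(_ v) := H2 u; rewrite gvu /=.
    by case: eqP => _; case: eqP => _; rewrite ?mul0r ?mulr0.
  have x_rho u v : g u v -> x (rho u v) (rho v u) = z u v.
    move=> uv; have vu : g v u by rewrite gC.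
    rewrite /x big1 ?add0r => [|w _]; last first.
      have [_ y0 _] := yP w; rewrite y0 //; apply: contraTN (guv _ _ uv).
      move=> /and3P[_ uw vw]; rewrite negbK; apply/eqP.
      by rewrite (bI _ _ _ (rhob _ _ uv) uw) (bI _ _ _ (rhob _ _ vu) vw).
    rewrite (bigD1 u) //= (bigD1 v) //= !eqxx !mulr1 ?addr0.
    rewrite big1 ?addr0 => [|w wv]; last first.
      case guw: (g u w); last by rewrite z0 ?guw ?mul0r.
      case: (rho v u =P rho w u) => [E|]; last by rewrite !mulr0.
      move: wv; rewrite (bI w v (rho v u)) ?eqxx ?rhob //.
      by rewrite E rhob // gC.
    rewrite big1 ?addr0 // => w wu; apply: big1 => w' _.
    case guw: (g w w'); last by rewrite z0 ?guw ?mul0r.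
    case: (rho u v =P rho w w') => [E|]; last by rewrite mul0r !mulr0.
    by move: wu; rewrite (bI w u (rho u v)) ?eqxx ?rhob // E rhob.
  (* The lift vanishes on deleted edges, so [c] agrees on faces that are merged. *)
  have c_root a : c (fingraph.root r a) = c a.
    apply/esym/(@connect_const _ r) => [{}a a' /existsP[s /existsP[t]]|]; last exact: connect_root.
    move=> /and3P[est nst /orP[]/andP[/eqP-> /eqP->]]; apply/eqP;
    rewrite -F2_add_eq0 ?[_ + c (L _ _)]addrC -cP //;
    by apply/eqP/x_out.
  by exists c => u v uv; rewrite !c_root -cP ?x_rho ?rhoe.
(* Conversely, a function that is constant on merged faces has a boundary vanishing on deleted
   edges. *)
pose c' := c \o fingraph.root r.
pose x s t := if e s t then c' (L s t) + c' (R s t) else 0.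
have [xC x0 xS] : even_chain e x := D2 c'.
have x_out s t : ~~ inH s t -> x s t = 0.
  move=> nst; case est: (e s t); last by rewrite x0 ?est.
  rewrite /x est /c' /=.
  suff /eqP-> : fingraph.root r (L s t) == fingraph.root r (R s t) by exact: F2_addxx.
  rewrite root_connect //; apply: connect1; apply/existsP; exists s; apply/existsP; exists t.
  by rewrite est nst !eqxx.
have x_rho u v : g u v -> c (fingraph.root r (L (rho u v) (rho v u))) +
   c (fingraph.root r (R (rho u v) (rho v u))) = x (rho u v) (rho v u).
  by move=> uv; rewrite /x rhoe.
split=> [u v|u v /negbTE->//|u].
  rewrite [g v u]gC; case: ifP => // uv.
  have vu : g v u by rewrite gC.
  by rewrite (x_rho u v uv) (x_rho v u vu) xC.
rewrite -big_mkcond /=.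
transitivity (\sum_(v | g u v) x (rho u v) (rho v u)).
  by apply: eq_bigr => v; apply: x_rho.
(* The degrees in [b u] sum to zero and the inner edges cancel, so the values on the edges leaving
   [b u] sum to zero. *)
have : \sum_(s in b u) \sum_t x s t = 0 by apply: big1.
under eq_bigr do rewrite (bigID (mem (b u))) /=.
rewrite big_split /= chain_in_sum0 ?add0r; [|exact: xC|by move=> s; rewrite x0 ?eI].
move=> E0; rewrite -[RHS]E0.
(* Only kept edges leave [b u] with a nonzero value, and the outer end of such an edge determines
   [v], as branch sets are disjoint. *)
transitivity (\sum_(s in b u) \sum_(t | t \notin b u) \sum_(v | g u v)
   x (rho u v) (rho v u) * ((s == rho u v)%:R * (t == rho v u)%:R)).
  under [RHS]eq_bigr do rewrite exchange_big /=.
  rewrite [RHS]exchange_big /=. apply: eq_bigr => v uv.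
  rewrite (bigD1 (rho u v)) ?rhob //= (bigD1 (rho v u)) /=; last first.
    apply: contraTN (guv _ _ uv) => H; rewrite negbK; apply/eqP.
    by apply: bI H (rhob v u _); rewrite gC.
  rewrite !eqxx !mulr1 big1 ?addr0 => [|t /andP[_ /negbTE->]]; last by rewrite !mulr0.
  rewrite big1 ?addr0 // => s /andP[_ /negbTE->]; apply: big1 => t _.
  by rewrite mul0r mulr0.
apply: eq_bigr => s sb; apply: eq_bigr => t tb.
case nst: (inH s t); last first.
  rewrite x_out ?nst // big1 // => v uv.
  case: (s =P _) => [E|]; last by rewrite mul0r mulr0.
  case: (t =P _) => [E'|]; last by rewrite !mulr0.
  by rewrite -E -E' x_out ?nst ?mul0r.
case/orP: nst => [/existsP[v /andP[sv tv]]|].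
  by move: tb; rewrite (bI _ _ _ sb sv) tv.
case/existsP=> u' /existsP[v /and3P[uv /eqP sE /eqP tE]].
have E : u' = u by apply: bI (rhob _ _ uv) _; rewrite -sE.
rewrite E in uv sE tE; rewrite (bigD1 v) //= -sE -tE !eqxx !mulr1.
rewrite big1 ?addr0 // => w /andP[uw wv].
case: (t =P _) => [E'|]; last by rewrite !mulr0.
move: wv; rewrite (bI w v t) ?eqxx //; first by rewrite E' rhob // gC.
by rewrite tE rhob // gC.
Qed.

(* Subdividing each arc uv by a vertex with branch set [a u v] need not give a minor
   model, as [a u v] overlaps [b u] and [b v]; the part [X u v] of [a u v] that is
   reachable from [b u] without entering [b v] is added to the branch set of u. *)
Lemma planar_dual_touching (P T V : finType) (p0 : P) (e : rel P) (L R : P -> P -> T)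
    (arc : rel V) (b : V -> {set P}) (a : V -> V -> {set P}) :
  symmetric e -> irreflexive e -> oriented arc -> planar_dual e L R ->
  (forall u v s, s \in b u -> s \in b v -> u = v) ->
  (forall v, connected_in e (b v)) ->
  (forall u v, arc u v -> connected_in e (a u v)) ->
  (forall u v, arc u v -> exists2 s, s \in a u v & s \in b u) ->
  (forall u v, arc u v -> exists2 s, s \in a u v & s \in b v) ->
  (forall u v w s, arc u v -> s \in a u v -> s \in b w -> w = u \/ w = v) ->
  (forall u v u' v' s, arc u v -> arc u' v' -> s \in a u v -> s \in a u' v' ->
     u = u' /\ v = v') ->
  exists L' R' : V -> V -> T, planar_dual (underlying arc) L' R'.
Proof.
move=> eC eI [irr asym] dual bI bcon acon abu abv ab aI.
pose res u v : rel P := fun s t => [&& e s t, s \in a u v :\: b v & t \in a u v :\: b v].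
pose X u v := [set q | [exists s, (s \in a u v) && (s \in b u) && connect (res u v) s q]].
have Xa u v q : arc u v -> q \in X u v -> (q \in a u v) && (q \notin b v).
  move=> uv; rewrite inE => /existsP[s /andP[/andP[sa sb] sq]].
  have sA : s \in a u v :\: b v.
    rewrite inE sa andbT; apply/negP => /(bI _ _ _ sb) E.
    by move: uv; rewrite -E irr.
  have : (s \in a u v :\: b v) = (q \in a u v :\: b v).
    apply: (@connect_const _ (res u v) _ (fun z => z \in a u v :\: b v)) sq => x y.
    by case/and3P=> _ -> ->.
  by rewrite sA inE andbC => <-.
have X_start u v s : s \in a u v -> s \in b u -> s \in X u v.
  by move=> sa sb; rewrite inE; apply/existsP; exists s; rewrite sa sb connect0.
(* Otherwise [X u v] would absorb the connected set [a u v], which contains a point of [b v]. *)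
have X_exit u v : arc u v -> exists f : P * P,
    [/\ f.1 \in X u v, f.2 \in b v & e f.1 f.2].
  move=> uv; apply: contrapT => noexit.
  have [s0 s0a s0b] := abu _ _ uv; have [t ta tb] := abv _ _ uv.
  suff /Xa - /(_ uv) : t \in X u v by rewrite tb andbF.
  apply: (acon _ _ uv (fun s => s \in X u v)) => //.
    by exists s0 => //; apply: X_start.
  move=> x y xa ya exy xX; have xX' := xX.
  move: xX'; rewrite !inE => /existsP[s /andP[sab sx]].
  apply/existsP; exists s; rewrite sab /=; apply: connect_trans sx (connect1 _).
  have /andP[_ xb] := Xa _ _ _ uv xX.
  rewrite /res exy !inE xa xb ya !andbT /=; apply/negP => yb.
  by apply: noexit; exists (x, y).
have /choice[f fP] : forall uv : V * V, exists f : P * P, arc uv.1 uv.2 ->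
    [/\ f.1 \in X uv.1 uv.2, f.2 \in b uv.2 & e f.1 f.2].
  move=> [u v] /=; case uv: (arc u v); last by exists (p0, p0).
  by have [f fP] := X_exit _ _ uv; exists f.
(* The exit edge of an arc has its first end in the enlarged branch set of the tail and its second
   end in that of the head. *)
pose rho u v := if arc u v then (f (u, v)).1 else (f (v, u)).2.
pose b' u := [set q | (q \in b u) || [exists w, arc u w && (q \in X u w)]].
have arcC u v : arc u v -> arc v u = false.
  by move=> uv; apply/negP => vu; apply: (asym u v).
apply: (@planar_dual_minor _ _ _ e L R _ b' rho) => //.
- by move=> u v; rewrite /underlying orbC.
- by move=> u; rewrite /underlying irr.
(* The set [X v w] lies in [a v w], which meets only [b v] and [b w], and it avoids [b w] by
   construction. *)
- have bX u v w s : arc v w -> s \in b u -> s \in X v w -> u = v.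
    move=> vw sb /(Xa _ _ _ vw)/andP[sa nb].
    by have [//|E] := ab _ _ _ _ vw sa sb; move: nb; rewrite -E sb.
  move=> u v s; rewrite !inE => /orP[sb|/existsP[w /andP[uw sX]]].
    move=> /orP[|/existsP[w /andP[vw sX]]]; first exact: bI.
    exact: bX vw sb sX.
  move=> /orP[sb|/existsP[w' /andP[vw' sX']]]; first exact/esym/(bX _ _ _ _ uw sb sX).
  have /andP[sa _] := Xa _ _ _ uw sX; have /andP[sa' _] := Xa _ _ _ vw' sX'.
  by have [] := aI _ _ _ _ _ uw vw' sa sa'.
- move=> v Y [s sb' sY] Yclosed.
  have bsub q : q \in b v -> q \in b' v by rewrite inE => ->.
  have Xsub w q : arc v w -> q \in X v w -> q \in b' v.
    by move=> vw qX; rewrite inE; apply/orP; right; apply/existsP; exists w; rewrite vw.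
  have XY w x y : arc v w -> x \in X v w -> res v w x y -> (y \in X v w) /\ (Y x <-> Y y).
    move=> vw xX xy; have yX : y \in X v w.
      move: xX; rewrite !inE => /existsP[z /andP[zab zx]].
      by apply/existsP; exists z; rewrite zab (connect_trans zx (connect1 xy)).
    split=> //; move: xy; rewrite /res => /and3P[exy _ _].
    have [xb yb] := (Xsub _ _ vw xX, Xsub _ _ vw yX).
    by split; apply: Yclosed; rewrite // eC.
  have conn w x y : arc v w -> x \in X v w -> connect (res v w) x y -> (Y x <-> Y y).
    move=> vw + /connectP[p]; elim: p x => [|z p IH] x /= xX; first by move=> _ ->.
    move=> /andP[xz zp] yE; have [zX ->] := XY _ _ _ vw xX xz.
    exact: IH.
  (* Every point of [b' v] is reached from [b v] without leaving [b' v]. *)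
  have start q : q \in b' v -> exists2 s0, s0 \in b v & (Y s0 <-> Y q).
    rewrite inE => /orP[qb|/existsP[w /andP[vw]]]; first by exists q.
    rewrite inE => /existsP[z /andP[/andP[za zb] zq]]; exists z => //.
    by apply: conn zq => //; apply: X_start.
  have bY : forall q, q \in b v -> Y q.
    apply: bcon => [|x y xb yb exy]; last by apply: Yclosed => //; apply: bsub.
    by have [s0 s0b s0Y] := start _ sb'; exists s0 => //; apply/s0Y.
  by move=> q /start[s0 /bY s0Y <-].
- move=> u v /orP[uv|vu]; rewrite /rho inE.
    rewrite uv; have [/= fX _ _] := fP (u, v) uv.
    by apply/orP; right; apply/existsP; exists v; rewrite uv.
  by rewrite arcC //; have [/= _ -> _] := fP (v, u) vu.
- move=> u v /orP[uv|vu]; rewrite /rho ?uv ?vu (arcC _ _ _) //.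
    by have [] := fP (u, v) uv.
  by rewrite eC; have [] := fP (v, u) vu.
Qed.

(** * The faces of a grid *)

Section GridDual.
Variable n : nat.
Local Notation N := n.+1.
Local Notation P := ('I_N * 'I_N)%type.

Definition grid_adj : rel P := fun s t =>
  ((s.1 == t.1) && ((s.2.+1 == t.2 :> nat) || (t.2.+1 == s.2 :> nat))) ||
  ((s.2 == t.2) && ((s.1.+1 == t.1 :> nat) || (t.1.+1 == s.1 :> nat))).

Lemma grid_adj_sym : symmetric grid_adj.
Proof.
by move=> s t; rewrite /grid_adj ![t.1 == s.1]eq_sym ![t.2 == s.2]eq_sym
  [(t.2.+1 == _) || _]orbC [(t.1.+1 == _) || _]orbC.
Qed.

Lemma grid_adj_irr : irreflexive grid_adj.
Proof. by move=> s; rewrite /grid_adj; lia. Qed.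

(* (i, j) is the upper right corner of its face; all faces reaching outside the
   grid are identified with the face (0, 0). *)
Definition grid_face (i j : nat) : P :=
  if (0 < i < N)%N && (0 < j < N)%N then (inord i, inord j) else (ord0, ord0).

(** The face below a horizontal edge or to the left of a vertical one; [grid_right] is the face on
    the other side. *)
Definition grid_left (s t : P) : P := grid_face (maxn s.1 t.1) (maxn s.2 t.2).

Definition grid_right (s t : P) : P :=
  if s.1 == t.1 then grid_face s.1.+1 (maxn s.2 t.2)
  else grid_face (maxn s.1 t.1) s.2.+1.

(** Extension by zero, so that missing neighbours at the border contribute nothing. *)
Definition grid_at (F : P -> 'F_2) (i j : nat) : 'F_2 :=
  if (i < N)%N && (j < N)%N then F (inord i, inord j) else 0.

(** The value at i - 1, but 0 at i = 0, where the truncated predecessor would give [F 0]. *)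
Definition pre_at (F : nat -> 'F_2) (i : nat) : 'F_2 := if i is k.+1 then F k else 0.

Lemma grid_sum_at (F : P -> 'F_2) i j :
  \sum_(t : P | (t.1 == i :> nat) && (t.2 == j :> nat)) F t = grid_at F i j.
Proof.
rewrite /grid_at; case: ifP => [/andP[iN jN]|nij].
  rewrite (big_pred1 (inord i, inord j)) // => -[a b] /=.
  by rewrite xpair_eqE -!val_eqE /= !inordK.
rewrite big_pred0 // => -[a b] /=; apply: contraFF nij => /andP[/eqP<- /eqP<-].
by rewrite !ltn_ord.
Qed.

(** The terms belong to the right, left, upper and lower neighbours, in this order. *)
Lemma grid_sum_adj (F : P -> 'F_2) (s : P) :
  \sum_t (if grid_adj s t then F t else 0) =
  grid_at F s.1.+1 s.2 + pre_at (grid_at F ^~ s.2) s.1 +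
  grid_at F s.1 s.2.+1 + pre_at (grid_at F s.1) s.2.
Proof.
have preE1 : pre_at (grid_at F ^~ s.2) s.1 =
    \sum_(t : P | (t.1.+1 == s.1 :> nat) && (t.2 == s.2 :> nat)) F t.
  case: s => -[[|i] iN] j /=; first by rewrite big_pred0.
  by rewrite -grid_sum_at.
have preE2 : pre_at (grid_at F s.1) s.2 =
    \sum_(t : P | (t.1 == s.1 :> nat) && (t.2.+1 == s.2 :> nat)) F t.
  case: s {preE1} => i [[|j] jN] /=; first by rewrite big_pred0 // => t; rewrite andbF.
  by rewrite -grid_sum_at.
rewrite preE1 preE2 -!grid_sum_at [X in X + _ + _ + _]big_mkcond
  [X in _ + X + _ + _]big_mkcond [X in _ + X + _]big_mkcond [X in _ + X]big_mkcond -!big_split /=.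
apply: eq_bigr => t _; rewrite /grid_adj -!val_eqE /=.
set b1 := (t.1 == _ :> nat) && _; set b2 := (t.1.+1 == _ :> nat) && _.
set b3 := (t.1 == _ :> nat) && _; set b4 := (t.1 == _ :> nat) && _.
have one : (b1 + b2 + b3 + b4 <= 1)%N by rewrite /b1 /b2 /b3 /b4; lia.
have -> : (s.1 == t.1 :> nat) && ((s.2.+1 == t.2 :> nat) || (t.2.+1 == s.2 :> nat))
       || (s.2 == t.2 :> nat) && ((s.1.+1 == t.1 :> nat) || (t.1.+1 == s.1 :> nat))
       = [|| b1, b2, b3 | b4] by rewrite /b1 /b2 /b3 /b4; lia.
by case: b1 b2 b3 b4 one => [] [] [] [] //= _; rewrite ?addr0 ?add0r.
Qed.

(** For an even chain, the value of a face is the parity of the crossings of a ray running to the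
    left. Conversely, the degree of a boundary at a vertex counts each of the four surrounding faces
    twice. *)
Lemma grid_planar_dual : planar_dual grid_adj grid_left grid_right.
Proof.
have LC s t : grid_left s t = grid_left t s by rewrite /grid_left maxnC [maxn s.2 _]maxnC.
have RC s t : grid_adj s t -> grid_right s t = grid_right t s.
  rewrite /grid_right eq_sym [maxn s.1 _]maxnC [maxn s.2 _]maxnC /grid_adj eq_sym.
  by case: (eqVneq t.1 s.1) => [->|ne] //= /andP[/eqP->].
split=> [x [xC x0 xS]|c].
  (* [h i j] and [w i j] are the values on the edges from (i, j) to the right and upwards. *)
  pose h i j := if (i.+1 < N)%N && (j < N)%N then
    x (inord i, inord j) (inord i.+1, inord j) else 0.
  pose w i j := if (i < N)%N && (j.+1 < N)%N then
    x (inord i, inord j) (inord i, inord j.+1) else 0.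
  have hw i j : (i < N)%N -> (j < N)%N ->
      h i j + pre_at (h ^~ j) i + w i j + pre_at (w i) j = 0.
    move=> iN jN; pose s : P := (inord i, inord j).
    have s1 : s.1 = i :> nat by rewrite inordK.
    have s2 : s.2 = j :> nat by rewrite inordK.
    have sum_x : \sum_t (if grid_adj s t then x s t else 0) = 0.
      rewrite -[RHS](xS s); apply: eq_bigr => t _.
      by case: ifP => // nst; rewrite x0 ?nst.
    rewrite -[RHS]sum_x grid_sum_adj s1 s2; congr (_ + _ + _ + _).
    - case: (i) iN @s {s1 s2 sum_x} => //= k kN; rewrite /h /grid_at kN jN (ltnW kN) /=.
      by rewrite xC.
    - case: (j) jN @s {s1 s2 sum_x} => //= k kN; rewrite /w /grid_at kN iN (ltnW kN) /=.
      by rewrite xC.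
  (* The ray from the face (i, j) crosses the vertical edges at abscissas k < i between heights j -
     1 and j. *)
  pose C i j := \sum_(k < i) pre_at (w k) j.
  (* Faces on the two sides of a horizontal edge differ by its value: induction on [i], using the
     even degree at each vertex. *)
  have CD i j : (i <= N)%N -> (j < N)%N -> C i j + C i j.+1 = pre_at (h ^~ j) i.
    move=> + jN; elim: i => [|i IH] iN; first by rewrite /C !big_ord0 addr0.
    rewrite /C !big_ord_recr /= addrACA IH ?(ltnW iN) //.
    have /eqP := hw i j iN jN; rewrite -!addrA F2_add_eq0 => /eqP->.
    by rewrite [pre_at (w i) j + _]addrC.
  (* [C] vanishes at all border indices, in agreement with its value at the outer face (0, 0). *)
  have Cx0 i : C i 0%N = 0 by apply: big1.
  have CxN i : C i N = 0 by apply: big1 => k _; rewrite /= /w ltnn andbF.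
  have C0x j : C 0%N j = 0 by rewrite /C big_ord0.
  have CNx j : (j <= N)%N -> C N j = 0.
    elim: j => // j IH jN; have := CD N j (leqnn _) jN.
    by rewrite IH ?(ltnW jN) // add0r => ->; rewrite /= /h ltnn.
  pose c (p : P) := C p.1 p.2.
  have cE i j : (i <= N)%N -> (j <= N)%N -> c (grid_face i j) = C i j.
    move=> iN jN; rewrite /c /grid_face; case: ifP => [|out] /=.
      by move=> /andP[/andP[_ iN'] /andP[_ jN']]; rewrite !inordK.
    rewrite C0x; have [->//|i0] := posnP i; have [->//|j0] := posnP j.
    have [->|iN'] := eqVneq i N; first by rewrite CNx.
    have [->|jN'] := eqVneq j N; first by rewrite CxN.
    by move: out; rewrite i0 j0 !ltn_neqAle iN' jN' iN jN.
  have ordE k (kN : (k < N)%N) : inord k = Ordinal kN.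
    by apply: val_inj; rewrite /= inordK.
  have horiz (s t : P) : s.1.+1 = t.1 :> nat -> s.2 = t.2 :> nat ->
      x s t = c (grid_left s t) + c (grid_right s t).
    case: s t => -[i iN] [j jN] [[i' iN'] [j' jN']] /= E1 E2; subst i' j'.
    rewrite /grid_left /grid_right -val_eqE /= maxnn (maxn_idPr (leqnSn _)).
    rewrite (_ : (i == i.+1) = false) ?cE ?(ltnW jN) //; last by lia.
    by rewrite CD //= /h iN' jN /= !ordE (bool_irrelevance jN' jN).
  have vert (s t : P) : s.1 = t.1 :> nat -> s.2.+1 = t.2 :> nat ->
      x s t = c (grid_left s t) + c (grid_right s t).
    case: s t => -[i iN] [j jN] [[i' iN'] [j' jN']] /= E1 E2; subst i' j'.
    rewrite /grid_left /grid_right -val_eqE /= eqxx maxnn (maxn_idPr (leqnSn _)).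
    rewrite !cE ?(ltnW iN) // /C big_ord_recr /= addrA F2_addxx add0r.
    by rewrite /w iN jN' /= !ordE (bool_irrelevance iN' iN).
  exists c => s t; rewrite /grid_adj -!val_eqE /=.
  case/orP=> /andP[/eqP st1 /orP[]/eqP st2].
  - exact: vert.
  - by rewrite xC LC RC; [exact: vert | rewrite /grid_adj -!val_eqE /= st1 st2 !eqxx ?orbT].
  - exact: horiz.
  - by rewrite xC LC RC; [exact: horiz | rewrite /grid_adj -!val_eqE /= st1 st2 !eqxx ?orbT].
pose C i j := c (grid_face i j).
have C_in i j : c (grid_face i j) = C i j by [].
have C0x j : C 0%N j = C 0%N 0%N by [].
have Cx0 i : C i 0%N = C 0%N 0%N by rewrite /C /grid_face andbF.
have CNx j : C N j = C 0%N 0%N by rewrite /C /grid_face ltnn andbF.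
have CxN i : C i N = C 0%N 0%N by rewrite /C /grid_face ltnn !andbF.
split=> [s t|s t /negbTE->//|s].
  by rewrite grid_adj_sym; case: ifP => // ts; rewrite LC RC // grid_adj_sym.
rewrite (grid_sum_adj (fun t => c (grid_left s t) + c (grid_right s t))).
case: s => -[i iN] [j jN] /=.
pose F (t : P) := c (grid_left (Ordinal iN, Ordinal jN) t) +
                  c (grid_right (Ordinal iN, Ordinal jN) t).
(* An edge missing at the border would have the outer face on both sides, so this formula and its
   three analogues hold there too. *)
have right_ : grid_at F i.+1 j = C i.+1 j + C i.+1 j.+1.
  rewrite /grid_at jN andbT; case: ifP => [iN'|/negbT].
    rewrite /F /grid_left /grid_right -val_eqE /= !inordK // maxnn.
    by rewrite (maxn_idPr (leqnSn _)) (_ : (i == i.+1) = false) ?C_in //; lia.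
  rewrite -leqNgt => iN'; have -> : i.+1 = N by lia.
  by rewrite !CNx F2_addxx.
have left_ : pre_at (grid_at F ^~ j) i = C i j + C i j.+1.
  case: i iN @F {right_} => [|i] iN F /=; first by rewrite C0x [C 0%N j.+1]C0x F2_addxx.
  rewrite /grid_at jN (ltnW iN) /F /grid_left /grid_right -val_eqE /= !inordK // ?(ltnW iN) //.
  by rewrite maxnn (maxn_idPl (leqnSn _)) (_ : (i.+1 == i) = false) ?C_in //; lia.
have up_ : grid_at F i j.+1 = C i j.+1 + C i.+1 j.+1.
  rewrite /grid_at iN /=; case: ifP => [jN'|/negbT].
    rewrite /F /grid_left /grid_right -val_eqE /= !inordK // maxnn.
    by rewrite (maxn_idPr (leqnSn _)) eqxx ?C_in.
  rewrite -leqNgt => jN'; have -> : j.+1 = N by lia.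
  by rewrite !CxN F2_addxx.
have down_ : pre_at (grid_at F i) j = C i j + C i.+1 j.
  case: j jN @F {right_ left_ up_} => [|j] jN F /=; first by rewrite !Cx0 F2_addxx.
  rewrite /grid_at iN (ltnW jN) /F /grid_left /grid_right -val_eqE /= !inordK // ?(ltnW jN) //.
  by rewrite maxnn (maxn_idPl (leqnSn _)) eqxx ?C_in.
rewrite -/F right_ left_ up_ down_ -[X in X = _]addrA.
rewrite [C i j.+1 + C i.+1 j.+1 + _]addrACA [C i j.+1 + C i j]addrC [C i.+1 j.+1 + C i.+1 j]addrC.
by rewrite [C i j + C i j.+1 + (C i.+1 j + _)]addrC F2_addxx.
Qed.

End GridDual.

End CycleSpace.

(** * Discretising compact connected sets *)

Section Discretise.
Local Open Scope classical_set_scope.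
Local Open Scope ring_scope.
Variable R : realType.
Implicit Types A B : set (R * R).

(** The distances form a compact set of reals that misses 0. *)
Lemma compact_disjoint_dist A B : compact A -> compact B -> A `&` B = set0 ->
  exists2 e : R, 0 < e & forall x y, A x -> B y -> e <= `|x - y|.
Proof.
move=> cA cB AB0.
pose d (z : (R * R) * (R * R)) : R := `|z.1 - z.2|.
have d_cont : continuous d.
  by move=> z; apply: cvg_norm; apply: cvgB; [exact: cvg_fst | exact: cvg_snd].
have cD : compact (d @` (A `*` B)).
  by apply: continuous_compact (compact_setX cA cB); apply: continuous_subspaceT.
have oD : open (~` (d @` (A `*` B))).
  by apply: closed_openC; apply: compact_closed cD; apply: Rhausdorff.
have : nbhs (0 : R) (~` (d @` (A `*` B))).
  apply: open_nbhs_nbhs; split=> // -[[x y] [/= Ax By]].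
  rewrite /d /= => /eqP; rewrite normr_eq0 subr_eq0 => /eqP xy.
  have : (A `&` B) x by split; rewrite // xy.
  by rewrite AB0.
case/nbhs_ballP => e /= e0 eD; exists e => // x y Ax By.
rewrite leNgt; apply/negP => lt; apply: (eD `|x - y|).
  by rewrite /ball /= sub0r normrN normr_id.
by exists (x, y).
Qed.

(** Closed squares of side [h], counted from the corner (-M, -M); neighbouring ones share sides or
    corners. *)
Definition cell (M h : R) (q : nat * nat) : set (R * R) :=
  `[- M + q.1%:R * h, - M + q.1.+1%:R * h] `*` `[- M + q.2%:R * h, - M + q.2.+1%:R * h].

Lemma cell_closed (M h : R) q : closed (cell M h q).
Proof.
apply: compact_closed; first exact: norm_hausdorff.
by apply: compact_setX; apply: segment_compact.
Qed.

(** The norm on pairs is the maximum norm, so the diameter equals the side. *)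
Lemma cell_dist (M h : R) q x y : cell M h q x -> cell M h q y -> `|x - y| <= h.
Proof.
have hS i : i.+1%:R * h = i%:R * h + h by rewrite -natr1 mulrDl mul1r.
case: x y => x1 x2 [y1 y2] [] /=; rewrite !in_itv /= !hS => /andP[a1 a2] /andP[a3 a4].
case=> /=; rewrite !in_itv /= => /andP[b1 b2] /andP[b3 b4].
by rewrite prod_normE /= ge_max !ler_norml; apply/andP; split; apply/andP; split; lra.
Qed.

Lemma cell_cover (n : nat) (M h : R) (x : R * R) :
  0 < h -> n%:R * h = 2 * M -> `|x| < M ->
  exists q, [/\ (q.1 < n)%N, (q.2 < n)%N & cell M h q x].
Proof.
move=> h0 nh; rewrite prod_normE gt_max => /andP[x1 x2].
have one (y : R) : `|y| < M -> exists2 i, (i < n)%N &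
    - M + i%:R * h <= y <= - M + i.+1%:R * h.
  rewrite ltr_norml => /andP[y1 y2].
  have yh0 : 0 <= (y + M) / h by rewrite divr_ge0 ?ltW //; lra.
  exists (Num.truncn ((y + M) / h)).
    rewrite truncn_lt_nat // ltr_pdivrMr // nh; lra.
  have /andP[] := truncn_itv yh0.
  rewrite ler_pdivlMr // ltr_pdivrMr // => l1 l2; apply/andP; split; lra.
have [i iN iP] := one _ x1; have [j jN jP] := one _ x2.
by exists (i, j); split=> //; split; rewrite /= in_itv.
Qed.

(** Applied in both orders, this makes the indices of cells with a common point differ by at most
    one in each coordinate. *)
Lemma cell_meet (M h : R) q q' x : 0 < h -> cell M h q x -> cell M h q' x ->
  (q.1 <= q'.1.+1)%N /\ (q.2 <= q'.2.+1)%N.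
Proof.
move=> h0 [] /=; rewrite !in_itv /= => /andP[a1 a2] /andP[a3 a4].
case=> /=; rewrite !in_itv /= => /andP[b1 b2] /andP[b3 b4].
have le i j : - M + i%:R * h <= - M + j%:R * h -> (i <= j)%N.
  by rewrite lerD2l ler_pM2r // ler_nat.
by split; apply: le; [apply: le_trans a1 b2 | apply: le_trans a3 b4].
Qed.

(** * The cells of a grid that meet a given set *)

Section Cells.
Variables (n : nat) (M h : R).
Hypotheses (h0 : 0 < h) (nh : n.+1%:R * h = 2 * M).
Local Notation P := ('I_n.+1 * 'I_n.+1)%type.
Let Q (q : P) := cell M h (nat_of_ord q.1, nat_of_ord q.2).

Definition cells_meeting A : {set P} := [set q : P | `[< A `&` Q q !=set0 >]]%SET.

Lemma cells_meetingP A q : reflect (A `&` Q q !=set0) (q \in cells_meeting A).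
Proof. by rewrite inE; apply: asboolP. Qed.

Lemma cells_coverP (x : R * R) : `|x| < M -> exists q : P, Q q x.
Proof.
move=> /(cell_cover h0 nh)[[i j] [/= iN jN xQ]].
by exists (Ordinal iN, Ordinal jN).
Qed.

(** The cells with the property [X] and those without it have closed unions, which cover [A] and are
    disjoint on [A]; connectedness of [A] leaves only one of them. *)
Lemma cells_meeting_connected A : (forall x, A x -> `|x| < M) -> connected A ->
  connected_in (@grid_adj n) (cells_meeting A).
Proof.
move=> bA cA X [q0 q0A Xq0] Xadj q qA.
have share s t x : A x -> Q s x -> Q t x -> X s -> X t.
  move=> Ax sx tx Xs.
  have [le1 le2] := cell_meet h0 sx tx; have [le3 le4] := cell_meet h0 tx sx.
  (* Cells with a common point may be diagonal neighbours; this cell also contains the point and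
     links them. *)
  pose m : P := (t.1, s.2).
  have mx : Q m x by case: sx tx => _ sx2 [tx1 _]; split.
  have inA r : Q r x -> r \in cells_meeting A by move=> rx; apply/cells_meetingP; exists x.
  have Xm : X m.
    have [E|ne] := eqVneq s m; first by rewrite -E.
    apply: (Xadj s m) => //; try exact: inA.
    move: ne le1 le3; rewrite -pair_eqE /pair_eq /= eqxx andbT => ne le1 le3.
    by rewrite /grid_adj /= eqxx; move: ne; rewrite -val_eqE /=; lia.
  have [<-//|ne] := eqVneq m t.
  apply: (Xadj m t) => //; try exact: inA.
  move: ne le2 le4; rewrite -pair_eqE /pair_eq /= eqxx => ne le2 le4.
  by rewrite /grid_adj /= eqxx; move: ne; rewrite -val_eqE /=; lia.
pose U (Y : P -> Prop) := \bigcup_(r in [set r | Y r /\ r \in cells_meeting A]) Q r.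
have cU Y : closed (U Y).
  by apply: closed_bigcup => [|r _]; [exact: finite_finset | exact: cell_closed].
have AU x : A x -> U X x \/ U (fun r => ~ X r) x.
  move=> Ax; have [r xr] := cells_coverP (bA _ Ax).
  have rA : r \in cells_meeting A by apply/cells_meetingP; exists x.
  by have [Xr|nXr] := pselect (X r); [left | right]; exists r.
have AUU x : A x -> U X x -> ~ U (fun r => ~ X r) x.
  by move=> Ax [r [Xr _] rx] [s [nXs _] sx]; apply/nXs/(share r s x).
have : A `&` U X = A.
  apply: cA.
  - by move/cells_meetingP: (q0A) => [x [Ax q0x]]; exists x; split=> //; exists q0.
  - exists (~` U (fun r => ~ X r)); first exact/closed_openC/cU.
    apply/seteqP; split=> x [Ax]; first by move=> /(AUU _ Ax); split.
    by move=> nU; split=> //; have [] := AU _ Ax.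
  - by exists (U X) => //; apply: cU.
move=> AE; move/cells_meetingP: qA => [x [Ax qx]].
have : (A `&` U X) x by rewrite AE.
by case=> _ [r [Xr _] rx]; apply: (share r q x).
Qed.

Lemma cells_meeting_meet A B : (forall x, A x -> `|x| < M) -> A `&` B !=set0 ->
  exists2 q, q \in cells_meeting A & q \in cells_meeting B.
Proof.
move=> bA [x [Ax Bx]]; have [q xq] := cells_coverP (bA _ Ax).
by exists q; apply/cells_meetingP; exists x.
Qed.

Lemma cells_meeting_disjoint A B q e : (forall x y, A x -> B y -> e <= `|x - y|) ->
  h < e -> q \in cells_meeting A -> q \in cells_meeting B -> False.
Proof.
move=> eAB he /cells_meetingP[x [Ax xq]] /cells_meetingP[y [By yq]].
by have := le_lt_trans (le_trans (eAB _ _ Ax By) (cell_dist xq yq)) he; rewrite ltxx.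
Qed.

End Cells.

(** The mesh is finer than a common lower bound for the distances between disjoint members, so the
    cell sets intersect exactly when the members do. *)
Lemma discretise_compacts (I : finType) (S : I -> set (R * R)) :
  (forall i, compact (S i)) -> (forall i, connected (S i)) ->
  exists n (b : I -> {set 'I_n.+1 * 'I_n.+1}),
    [/\ forall i, connected_in (@grid_adj n) (b i),
        forall i j, S i `&` S j !=set0 -> exists2 q, q \in b i & q \in b j
      & forall i j q, q \in b i -> q \in b j -> S i `&` S j !=set0].
Proof.
move=> Sc Sconn.
have [M [M0 MP]] : exists M : R, 0 < M /\ forall i x, S i x -> `|x| < M.
  have : \forall M \near +oo, forall i, forall x, S i x -> `|x| <= M.
    by apply: filter_forall => i; apply: (compact_bounded (Sc i)).
  move=> /(pinfty_ex_gt (num_real 0))[M M0 /= bM].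
  exists (M + 1); split=> [|i x /bM le]; first by rewrite addr_gt0.
  by rewrite (le_lt_trans le) // ltrDl.
have [e [e0 eP]] : exists e : R, 0 < e /\ forall i j, S i `&` S j = set0 ->
    forall x y, S i x -> S j y -> e <= `|x - y|.
  (* There are finitely many pairs, so bounds valid for all small [e] hold simultaneously. *)
  have near_e : \forall e \near 0^'+, forall p : I * I, S p.1 `&` S p.2 = set0 ->
      forall x y, S p.1 x -> S p.2 y -> e <= `|x - y|.
    apply: filter_forall => -[i j] /=.
    have [Sij|nSij] := pselect (S i `&` S j = set0); last by apply: filterE.
    have [d d0 dP] := compact_disjoint_dist (Sc i) (Sc j) Sij.
    apply: filterS (nbhs_right_lt d0) => e ed _ x y Six Sjy.
    exact: le_trans (ltW ed) (dP _ _ Six Sjy).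
  have [e [eP e0]] := filter_ex (filterI near_e (nbhs_right_gt (0 : R))).
  by exists e; split=> // i j; apply: (eP (i, j)).
(* Truncation gives n + 1 > 2M / e, hence h < e. *)
pose n := Num.truncn (2 * M / e); pose h := 2 * M / n.+1%:R.
have h0 : 0 < h by rewrite divr_gt0 // mulr_gt0.
have nh : n.+1%:R * h = 2 * M by rewrite /h mulrC divfK.
have he : h < e.
  by rewrite /h ltr_pdivrMr // -ltr_pdivrMl // mulrC truncnS_gt.
exists n, (fun i => cells_meeting n M h (S i)); split.
- by move=> i; apply: cells_meeting_connected => //; apply: MP.
- by move=> i j; apply: cells_meeting_meet => //; apply: MP.
- move=> i j q qi qj; apply/set0P/eqP => Sij.
  exact: cells_meeting_disjoint (eP _ _ Sij) he qi qj.
Qed.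

End Discretise.

(** * Plane drawings *)

Section Drawing.
Local Open Scope classical_set_scope.
Local Open Scope ring_scope.
Variables (R : realType) (V : finType) (arc : rel V).
Hypothesis arc_oriented : oriented arc.
Variables (p : V -> R * R) (C : {set V} -> set (R * R)).
Hypothesis drawing : plane_drawing (underlying arc) p C.
Variable g : V -> V -> R -> R * R.
Hypothesis gP : forall u v, arc u v ->
  [/\ {within `[0, 1], continuous (g u v)}, {in `[0, 1] &, injective (g u v)},
      g u v 0 = p u, g u v 1 = p v & C [set u; v]%SET = g u v @` `[0, 1]].

Let in01 (t : R) : 0 <= t <= 1 -> t \in `[0, 1].
Proof. by rewrite in_itv. Qed.

Lemma drawn_arc_mem u v t : arc u v -> 0 <= t <= 1 -> C [set u; v]%SET (g u v t).
Proof. by case/gP => _ _ _ _ -> t01; exists t => //=; rewrite in_itv. Qed.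

(** No vertex lies on the inner part of a curve, and injectivity fixes the parameter at its ends. *)
Lemma drawn_arc_vertex u v t y : arc u v -> 0 <= t <= 1 -> g u v t = p y ->
  (y = u /\ t = 0) \/ (y = v /\ t = 1).
Proof.
move=> uv t01 gt; have [p_inj _ noV _] := drawing.
have [_ g_inj g0 g1 _] := gP uv.
have inj s : 0 <= s <= 1 -> g u v t = g u v s -> t = s.
  by move=> s01; apply: g_inj; rewrite ?inE; apply: in01.
have euv : underlying arc u v by rewrite /underlying uv.
have : [set p u; p v] (p y).
  apply: contrapT => nend; apply: (noV _ _ y euv); split=> //.
  by rewrite -gt; apply: drawn_arc_mem.
case=> /p_inj E; [left | right]; split=> //; apply: inj; rewrite ?lexx ?ler01 //.
  by rewrite gt g0 E.
by rewrite gt g1 E.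
Qed.

(** Arcs with different end pairs meet only at vertices. Arcs with the same pair are equal, as there
    are no 2-cycles, and then injectivity gives the parameter. *)
Lemma drawn_arcs_cross u v u' v' t t' : arc u v -> arc u' v' ->
  0 <= t <= 1 -> 0 <= t' <= 1 -> g u v t = g u' v' t' ->
  [/\ u = u', v = v' & t = t'] \/ exists y, g u v t = p y.
Proof.
move=> uv uv' t01 t01' gE; have [_ _ _ cross] := drawing.
have [irr asym] := arc_oriented.
have [euv euv'] : underlying arc u v /\ underlying arc u' v'.
  by rewrite /underlying uv uv'.
have [E|ne] := eqVneq [set u; v]%SET [set u'; v']%SET; last first.
  right; apply: contrapT => npy.
  suff : ((C [set u; v]%SET `\` [set p u; p v]) `&` C [set u'; v']%SET) (g u v t).
    by rewrite (cross _ _ _ _ euv euv') //; apply/eqP.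
  split; last by rewrite gE; apply: drawn_arc_mem.
  split; first exact: drawn_arc_mem.
  by case=> E; apply: npy; eexists; exact: E.
left; have nuv : u != v by apply: contraTneq uv => ->; rewrite irr.
have := set21 u v; rewrite E !inE => /orP[]/eqP Eu; last first.
  have := set22 u v; rewrite E !inE => /orP[]/eqP Ev; last by rewrite Eu Ev eqxx in nuv.
  by case: (asym u v); split; rewrite // Eu Ev.
have := set22 u v; rewrite E !inE => /orP[]/eqP Ev; first by rewrite Eu Ev eqxx in nuv.
subst u' v'; have [_ g_inj _ _ _] := gP uv; split=> //.
by apply: g_inj gE; rewrite ?inE; apply: in01.
Qed.

(** * Stars and middle thirds of the arcs *)

Let third : R := 3^-1.
Let third_lt : 0 < third /\ third * 3 = 1.
Proof. by split; [rewrite invr_gt0 | rewrite mulVf]. Qed.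

(** First thirds of outgoing arcs and last thirds of incoming ones; every other index gives the
    point [p v], so each part is connected and contains [p v]. *)
Definition star_part v (i : option (bool * V)) : set (R * R) :=
  match i with
  | Some (true, w) => if arc v w then g v w @` `[0, third] else [set p v]
  | Some (false, w) => if arc w v then g w v @` `[2 * third, 1] else [set p v]
  | None => [set p v]
  end.

Definition star v : set (R * R) := \bigcup_i star_part v i.

Definition middle u v : set (R * R) :=
  if arc u v then g u v @` `[third, 2 * third] else set0.

Let sub_itv (a b : R) : 0 <= a -> b <= 1 -> `[a, b] `<=` `[0, 1].
Proof.
move=> a0 b1 t /=; rewrite !in_itv /= => /andP[at_ tb].
by rewrite (le_trans a0 at_) (le_trans tb b1).
Qed.

Let itv_image u v (a b : R) : arc u v -> 0 <= a -> b <= 1 ->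
  compact (g u v @` `[a, b]) /\ connected (g u v @` `[a, b]).
Proof.
move=> /gP[g_cont _ _ _ _] a0 b1.
have cab : {within `[a, b], continuous (g u v)}.
  by apply: continuous_subspaceW g_cont; apply: sub_itv.
split; first by apply: continuous_compact cab _; apply: segment_compact.
by apply: connected_continuous_connected cab; apply: segment_connected.
Qed.

Let star_part_compact_connected v i :
  [/\ compact (star_part v i), connected (star_part v i) & star_part v i (p v)].
Proof.
have [t0 t3] := third_lt.
have pt : [/\ compact [set p v], connected [set p v] & [set p v] (p v)].
  by split=> //; [exact: compact_set1 | exact: connected1].
case: i => [[[] w]|] //=; case: ifP => // vw.
  have [||c1 c2] := @itv_image v w 0 third vw; try lra.
  split=> //; exists 0; last by have [] := gP vw.
  by rewrite /= in_itv /=; lra.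
have [||c1 c2] := @itv_image w v (2 * third) 1 vw; try lra.
split=> //; exists 1; last by have [] := gP vw.
by rewrite /= in_itv /=; lra.
Qed.

Lemma star_compact v : compact (star v).
Proof.
rewrite /star -bigsetU_fset_set; last exact: finite_finset.
by apply: bigsetU_compact => i _; have [] := star_part_compact_connected v i.
Qed.

Lemma star_connected v : connected (star v).
Proof.
apply: bigcup_connected => [|i _]; last by have [] := star_part_compact_connected v i.
by exists (p v) => i _; have [] := star_part_compact_connected v i.
Qed.

Lemma middle_compact_connected u v : compact (middle u v) /\ connected (middle u v).
Proof.
have [t0 t3] := third_lt.
rewrite /middle; case: ifP => uv; last by split; [exact: compact0 | exact: connected0].
by apply: itv_image => //; lra.
Qed.

Let star_inv v x : star v x -> x = p v \/ exists a b t,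
  [/\ arc a b, 0 <= t <= 1, x = g a b t & (a = v /\ t <= third) \/ (b = v /\ 2 * third <= t)].
Proof.
have [t0 t3] := third_lt.
case=> -[[[] w]|] _ /=; last by left.
  case: ifP => [vw [t]|_]; last by left.
  rewrite /= in_itv /= => /andP[l1 l2] <-; right; exists v, w, t; split=> //; last by left.
  by apply/andP; split; lra.
case: ifP => [vw [t]|_]; last by left.
rewrite /= in_itv /= => /andP[l1 l2] <-; right; exists w, v, t; split=> //; last by right.
by apply/andP; split; lra.
Qed.

Let star_vertex v y : star v (p y) -> y = v.
Proof.
have [t0 t3] := third_lt; have [p_inj _ _ _] := drawing.
case/star_inv => [/p_inj//|[a [b [t [ab t01 /esym gt side]]]]].
by have [[-> tE]|[-> tE]] := drawn_arc_vertex ab t01 gt; case: side => -[E le];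
  rewrite ?E //; exfalso; lra.
Qed.

(** A vertex lies in no star but its own. Any other common point lies on one arc at one parameter,
    which cannot be in both outer thirds. *)
Lemma star_disjoint u v x : star u x -> star v x -> u = v.
Proof.
have [t0 t3] := third_lt.
move=> ux vx; have [xE|[a [b [t [ab t01 xE side]]]]] := star_inv ux.
  by apply: star_vertex; rewrite -xE.
have [xE'|[a' [b' [t' [ab' t01' xE' side']]]]] := star_inv vx.
  by apply/esym/star_vertex; rewrite -xE'.
have [[Ea Eb Et]|[y gy]] := drawn_arcs_cross ab ab' t01 t01' (etrans (esym xE) xE').
  subst a' b' t'.
  by case: side side' => -[E1 l1] [] [E2 l2]; rewrite -?E1 -?E2 //; exfalso; lra.
by rewrite -xE in gy; rewrite gy in ux vx; rewrite -(star_vertex ux); apply: star_vertex.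
Qed.

Let middle_inv u v x : middle u v x -> arc u v /\
  exists t, [/\ 0 <= t <= 1, third <= t <= 2 * third & x = g u v t].
Proof.
have [t0 t3] := third_lt.
rewrite /middle; case: ifP => // uv [t]; rewrite /= in_itv /= => tt <-; split=> //.
by exists t; split=> //; lra.
Qed.

Let middle_vertex u v y : ~ middle u v (p y).
Proof.
have [t0 t3] := third_lt.
move=> /middle_inv[uv [t [t01 tt /esym gt]]].
by have [[_ tE]|[_ tE]] := drawn_arc_vertex uv t01 gt; lra.
Qed.

Lemma middle_star u v w x : middle u v x -> star w x -> w = u \/ w = v.
Proof.
move=> mx; have [uv [t [t01 tt xE]]] := middle_inv mx.
case/star_inv => [E|[a [b [t' [ab t01' xE' side]]]]].
  by rewrite E in mx; case: (middle_vertex mx).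
have [[Ea Eb Et]|[y gy]] := drawn_arcs_cross uv ab t01 t01' (etrans (esym xE) xE').
  by case: side => -[<- _]; [left | right]; rewrite ?Ea ?Eb.
by rewrite xE gy in mx; case: (middle_vertex mx).
Qed.

Lemma middle_disjoint u v u' v' x : middle u v x -> middle u' v' x -> u = u' /\ v = v'.
Proof.
move=> mx mx'; have [uv [t [t01 tt xE]]] := middle_inv mx.
have [uv' [t' [t01' _ xE']]] := middle_inv mx'.
have [[-> -> _]//|[y gy]] := drawn_arcs_cross uv uv' t01 t01' (etrans (esym xE) xE').
by rewrite xE gy in mx; case: (middle_vertex mx).
Qed.

Lemma middle_meets_tail u v : arc u v -> middle u v `&` star u !=set0.
Proof.
have [t0 t3] := third_lt.
move=> uv; exists (g u v third); split.
  by rewrite /middle uv; exists third => //=; rewrite in_itv /=; lra.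
exists (Some (true, v)) => //=; rewrite uv; exists third => //=.
by rewrite in_itv /=; lra.
Qed.

Lemma middle_meets_head u v : arc u v -> middle u v `&` star v !=set0.
Proof.
have [t0 t3] := third_lt.
move=> uv; exists (g u v (2 * third)); split.
  by rewrite /middle uv; exists (2 * third) => //=; rewrite in_itv /=; lra.
exists (Some (false, u)) => //=; rewrite uv; exists (2 * third) => //=.
by rewrite in_itv /=; lra.
Qed.

(** Stars and middles are discretised as one finite family, so that a single grid carries all the
    branch sets and their incidences are those of the drawing. *)
Lemma drawing_planar_dual : exists (T : finType) (L R : V -> V -> T),
  planar_dual (underlying arc) L R.
Proof.
pose S (i : V + V * V) := match i with inl v => star v | inr uv => middle uv.1 uv.2 end.
have [||n [b [b_conn b_meet b_disj]]] := @discretise_compacts R _ S.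
- by case=> [v|[u v]] /=; [exact: star_compact | have [] := middle_compact_connected u v].
- by case=> [v|[u v]] /=; [exact: star_connected | have [] := middle_compact_connected u v].
exists ('I_n.+1 * 'I_n.+1)%type.
apply: (planar_dual_touching (ord0, ord0) (b := fun v => b (inl v))
  (a := fun u v => b (inr (u, v))) (@grid_adj_sym n) (@grid_adj_irr n) arc_oriented
  (grid_planar_dual n)) => //.
- by move=> u v s su sv; have [x [xu xv]] := b_disj _ _ _ su sv; apply: star_disjoint xu xv.
- by move=> u v uv; apply: b_meet; apply: middle_meets_tail.
- by move=> u v uv; apply: b_meet; apply: middle_meets_head.
- by move=> u v w s _ sa sw; have [x [xa xw]] := b_disj _ _ _ sa sw; apply: middle_star xa xw.
- move=> u v u' v' s _ _ sa sa'; have [x [xa xa']] := b_disj _ _ _ sa sa'.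
  exact: middle_disjoint xa xa'.
Qed.

End Drawing.

(** * From planarity to a strong Seymour vertex *)

Section Planar.
Local Open Scope classical_set_scope.
Local Open Scope ring_scope.

Lemma planar_has_planar_dual (R : realType) (V : finType) (arc : rel V) :
  oriented arc -> planar R (underlying arc) ->
  exists (T : finType) (L R : V -> V -> T), planar_dual (underlying arc) L R.
Proof.
move=> arc_oriented [p [C drawing]]; have [_ arcs _ _] := drawing.
(* Each arc is parametrised from tail to head; other pairs get a constant map as default. *)
have /choice[g gP] : forall uv : V * V, exists f : R -> R * R, arc uv.1 uv.2 ->
    [/\ {within `[0, 1], continuous f}, {in `[0, 1] &, injective f},
        f 0 = p uv.1, f 1 = p uv.2 & C [set uv.1; uv.2]%SET = f @` `[0, 1]].
  move=> [u v] /=; case uv: (arc u v); last by exists (fun=> p u).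
  by have [|f fP] := arcs u v; [rewrite /underlying uv | exists f].
exact: (drawing_planar_dual arc_oriented drawing (fun u v => gP (u, v))).
Qed.

End Planar.

Theorem corollary1p6 (R : realType) (V : finType) (arc : rel V)
  (V_nonempty : (0 < #|V|)%N)
  (arc_oriented : oriented arc)
  (arc_planar : planar R (underlying arc)) :
  exists x : V, strong_seymour arc x.
Proof.
have [T [L [R' dual]]] := planar_has_planar_dual arc_oriented arc_planar.
apply: (strong_seymour_few_arcs arc_oriented).
exact: planar_dual_few_arcs dual.
Qed.
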